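(* Let $\mathcal{A}$ be a filtered commutative unital $\mathbb{R}$-algebra with filtration $(\mathcal{A}^{(k)})_{k\in\mathbb{N}_0}$, $\mathcal{S}$ a generating semiring of $\mathcal{A}$ and $\mathcal{C}\subseteq\mathcal{A}$ an $\mathcal{S}$-module. Suppose $s\in(1+\mathcal{S})\cap\mathcal{A}^{(1)}$ is compatible with the filtration of $\mathcal{A}$. Then, for any $k\in\mathbb{N}_0$ and $a\in\mathcal{A}^{(k)}$, the following are equivalent: (i) $\varphi(a)>0$ for all $\varphi\in\mathrm{char}(\mathcal{A},\mathcal{C})$, and $\psi([a]^{k\text{-}\mathrm{sb}})>0$ for all $\psi\in\mathrm{char}(\mathcal{A}^{\mathrm{sb}},\mathcal{C}^{\mathrm{sb}})$ with $\psi([s]^{1\text{-}\mathrm{sb}})=1$. (ii) There exist numbers $\epsilon\in(0,\infty)$ and $\ell\in\mathbb{N}_0$ such that $s^\ell a\in\epsilon s^{k+\ell}+\mathcal{C}$.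
   Context: Let $\mathcal{A}$ be a commutative unital $\mathbb{R}$-algebra with unit $1$. A convex cone in $\mathcal{A}$ is a non-empty subset closed under addition and under multiplication by real scalars $\lambda\ge0$. A semiring of $\mathcal{A}$ is a convex cone $\mathcal{S}$ with $1\in\mathcal{S}$ and $\mathcal{S}\cdot\mathcal{S}\subseteq\mathcal{S}$; it is generating if $\mathcal{A}=\mathcal{S}-\mathcal{S}$. An $\mathcal{S}$-module is a convex cone $\mathcal{C}$ with $1\in\mathcal{C}$ and $ac\in\mathcal{C}$ for all $a\in\mathcal{S}$, $c\in\mathcal{C}$. For a commutative unital $\mathbb{R}$-algebra $\mathcal{B}$ and $\mathcal{D}\subseteq\mathcal{B}$, $\mathrm{char}(\mathcal{B},\mathcal{D})$ denotes the set of unital algebra homomorphisms $\varphi:\mathcal{B}\to\mathbb{R}$ with $\varphi(b)\ge0$ for all $b\in\mathcal{D}$. Filtered algebra: $\mathcal{A}=\bigcup_{k\in\mathbb{N}_0}\mathcal{A}^{(k)}$ with linear subspaces $\mathcal{A}^{(k)}$ such that $1\in\mathcal{A}^{(0)}$, $\mathcal{A}^{(k)}\subseteq\mathcal{A}^{(k+1)}$ and $\mathcal{A}^{(k)}\mathcal{A}^{(\ell)}\subseteq\mathcal{A}^{(k+\ell)}$ for all $k,\ell\in\mathbb{N}_0$. Symbol algebra: set $\mathcal{A}^{(0)}_0:=\{0\}$ and, for $k\ge1$, $\mathcal{A}^{(k)}_0:=\{a\in\mathcal{A}^{(k)} : \text{there is } m\in\mathbb{N}=\{1,2,\dots\} \text{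 with } a^m\in\mathcal{A}^{(km-1)}\}$. Each $\mathcal{A}^{(k)}_0$ is a linear subspace of $\mathcal{A}^{(k)}$ and $\mathcal{A}^{(k)}_0\mathcal{A}^{(\ell)}\subseteq\mathcal{A}^{(k+\ell)}_0$. Let $[\,\cdot\,]^{k\text{-}\mathrm{sb}}:\mathcal{A}^{(k)}\to\mathcal{A}^{(k)}/\mathcal{A}^{(k)}_0$ be the quotient map. The algebra of symbols is the graded vector space $\mathcal{A}^{\mathrm{sb}}:=\bigoplus_{k\in\mathbb{N}_0}\mathcal{A}^{(k)}/\mathcal{A}^{(k)}_0$ with the (well-defined) bilinear product determined by $[a]^{k\text{-}\mathrm{sb}}[b]^{\ell\text{-}\mathrm{sb}}:=[ab]^{(k+\ell)\text{-}\mathrm{sb}}$; it is a commutative unital $\mathbb{R}$-algebra with unit $[1]^{0\text{-}\mathrm{sb}}$. Each quotient $\mathcal{A}^{(k)}/\mathcal{A}^{(k)}_0$ is identified with the corresponding subspace of $\mathcal{A}^{\mathrm{sb}}$. For a convex cone $\mathcal{C}$ of $\mathcal{A}$ with $1\in\mathcal{C}$: $\mathcal{C}^{\mathrm{sb}}:=\{\sum_{k=0}^K[c_k]^{k\text{-}\mathrm{sb}} : K\in\mathbb{N}_0,\ c_k\in\mathcal{C}\cap\mathcal{A}^{(k)} \text{ for } k=0,\dots,K\}$. An element $s\in(1+\mathcal{S})\cap\mathcal{A}^{(1)}$ is compatible with the filtration of $\mathcal{A}$ if for all $k\in\mathbb{N}_0$ and all $a\in\mathcal{A}^{(k)}$ there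 exists $\lambda\in(0,\infty)$ with $\lambda s^k-a\in\mathcal{S}$. *)

(* Defs.v *)
From HB Require Import structures.
From mathcomp Require Import all_boot all_order all_algebra.
From mathcomp Require Import boolp classical_sets reals.
From mathcomp Require Import zify ring.

Set Implicit Arguments.
Unset Strict Implicit.
Unset Printing Implicit Defensive.

Import Order.TTheory GRing.Theory Num.Theory.

Local Open Scope classical_set_scope.
Local Open Scope ring_scope.

Section Cones.
Variables (R : realType) (A : comAlgType R).
Implicit Types S C : set A.

Definition linear_subspace (E : set A) : Prop :=
  E 0 /\ forall (r : R) (x y : A), E x -> E y -> E (r *: x + y).

Definition convex_cone C : Prop :=
  [/\ C !=set0,
      forall x y : A, C x -> C y -> C (x + y)
    & forall (r : R) (x : A), 0 <= r -> C x -> C (r *: x)].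

Definition cone_semiring S : Prop :=
  [/\ convex_cone S, S 1 & forall a b : A, S a -> S b -> S (a * b)].

Definition generating S : Prop :=
  forall a : A, exists b c : A, [/\ S b, S c & a = b - c].

Definition cone_module S C : Prop :=
  [/\ convex_cone C, C 1 & forall a c : A, S a -> C c -> C (a * c)].

Record filtration := Filtration {
  filt :> nat -> set A;
  filt_subspace : forall k, linear_subspace (filt k);
  filt1 : filt 0%N 1;
  filtS : forall k, filt k `<=` filt k.+1;
  filtM : forall k l a b, filt k a -> filt l b -> filt (k + l)%N (a * b);
  filt_cover : \bigcup_k filt k = setT
}.

End Cones.

Definition char (R : realType) (B : comAlgType R) (D : set B) :
    set {lrmorphism B -> R | *%R} :=
  [set phi : {lrmorphism B -> R | *%R} | forall b, D b -> 0 <= phi b].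

Definition compatible (R : realType) (A : comAlgType R) (F : filtration A)
    (S : set A) (s : A) : Prop :=
  [/\ [set 1 + t | t in S] s, F 1%N s
    & forall (k : nat) (a : A), F k a ->
        exists2 lambda : R, 0 < lambda & S (lambda *: s ^+ k - a)].

(* [filt0 F k] is the subspace of those elements of degree at most k whose
   k-symbol vanishes. *)
Definition filt0 (R : realType) (A : comAlgType R) (F : filtration A)
    (k : nat) : set A :=
  if k is 0%N then [set 0]
  else [set a | F k a /\ exists2 m : nat, (0 < m)%N & F (k * m - 1)%N (a ^+ m)].

Section Filtration.
Variables (R : realType) (A : comAlgType R) (F : filtration A).

Lemma filt_0 k : F k 0. Proof. by case: (filt_subspace F k). Qed.

Lemma filt_lin k (r : R) x y : F k x -> F k y -> F k (r *: x + y).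
Proof. by case: (filt_subspace F k) => _; apply. Qed.

Lemma filtZ k (r : R) x : F k x -> F k (r *: x).
Proof. by move=> Fx; rewrite -[_ *: _]addr0; apply: filt_lin => //; exact: filt_0. Qed.

Lemma filtD k x y : F k x -> F k y -> F k (x + y).
Proof. by move=> Fx Fy; rewrite -[x]scale1r; exact: filt_lin. Qed.

Lemma filtN k x : F k x -> F k (- x).
Proof. by rewrite -scaleN1r; exact: filtZ. Qed.

Lemma filtMn k x n : F k x -> F k (x *+ n).
Proof. by rewrite -scaler_nat; exact: filtZ. Qed.

Lemma filt_sum k I (r : seq I) (P : pred I) (f : I -> A) :
  (forall i, P i -> F k (f i)) -> F k (\sum_(i <- r | P i) f i).
Proof. by move=> Ff; elim/big_ind: _ => //; [exact: filt_0|exact: filtD]. Qed.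

Lemma filt_le k l : (k <= l)%N -> F k `<=` F l.
Proof.
move=> /subnK <-; elim: (l - k)%N => [//|n IH] x Fx.
by rewrite addSn; apply: filtS; exact: IH.
Qed.

Lemma filtX k x n : F k x -> F (k * n)%N (x ^+ n).
Proof.
move=> Fx; elim: n => [|n IH]; first by rewrite muln0 expr0; exact: filt1.
by rewrite mulnS exprS; exact: filtM.
Qed.

Lemma filt0_filt k : filt0 F k `<=` F k.
Proof. by case: k => [x ->|k x []//]; exact: filt_0. Qed.

Lemma filt0_0 k : filt0 F k 0.
Proof.
case: k => [//|k]; split; first exact: filt_0.
by exists 1%N => //; rewrite expr1; exact: filt_0.
Qed.

Lemma filt0Z k (r : R) x : filt0 F k x -> filt0 F k (r *: x).
Proof.
case: k => [->|k [Fx [m m0 Fxm]]]; first by rewrite scaler0.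
split; first exact: filtZ.
by exists m => //; rewrite exprZn; exact: filtZ.
Qed.

Lemma filt0N k x : filt0 F k x -> filt0 F k (- x).
Proof. by rewrite -scaleN1r; exact: filt0Z. Qed.

Lemma filt0D k x y : filt0 F k x -> filt0 F k y -> filt0 F k (x + y).
Proof.
case: k => [-> ->|k [Fx [m m0 Fxm]] [Fy [n n0 Fyn]]]; first by rewrite addr0.
split; first exact: filtD.
exists (m + n)%N; first by rewrite addn_gt0 m0.
rewrite exprDn; apply: filt_sum => i _; apply: filtMn.
have [lin|lni] := leqP n i.
  have -> : (x ^+ (m + n - i) * y ^+ i =
             y ^+ n * (x ^+ (m + n - i) * y ^+ (i - n)))%R.
    by rewrite mulrCA -exprD subnKC.
  have -> : (k.+1 * (m + n) - 1 =
    (k.+1 * n - 1) + (k.+1 * (m + n - i) + k.+1 * (i - n)))%N.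
    have := ltn_ord i; nia.
  by apply: filtM => //; apply: filtM; exact: filtX.
have -> : (x ^+ (m + n - i) * y ^+ i =
           x ^+ m * (x ^+ (n - i) * y ^+ i))%R.
  by rewrite mulrA -exprD; congr (_ ^+ _ * _); lia.
have -> : (k.+1 * (m + n) - 1 =
  (k.+1 * m - 1) + (k.+1 * (n - i) + k.+1 * i))%N by nia.
by apply: filtM => //; apply: filtM; exact: filtX.
Qed.

Lemma filt0_sum k I (r : seq I) (P : pred I) (f : I -> A) :
  (forall i, P i -> filt0 F k (f i)) -> filt0 F k (\sum_(i <- r | P i) f i).
Proof. by move=> Ff; elim/big_ind: _ => //; [exact: filt0_0|exact: filt0D]. Qed.

Lemma filt0Ml k l x y : filt0 F k x -> F l y -> filt0 F (k + l)%N (x * y).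
Proof.
case: k => [-> _|k [Fx [m m0 Fxm]] Fy]; first by rewrite mul0r; exact: filt0_0.
split; first exact: (filtM Fx Fy).
exists m => //; rewrite exprMn.
have -> : ((k + l).+1 * m - 1 = (k.+1 * m - 1) + l * m)%N by nia.
by apply: filtM => //; exact: filtX.
Qed.

Lemma filt0Mr k l x y : F k x -> filt0 F l y -> filt0 F (k + l)%N (x * y).
Proof. by move=> Fx Fy; rewrite mulrC addnC; exact: filt0Ml. Qed.

(* The element a + A^(k)_0 of the quotient A^(k) / A^(k)_0. *)
Definition sbcoset (k : nat) (a : A) : set A := [set a + x | x in filt0 F k].

Lemma sbcosetP k a b : sbcoset k a = sbcoset k b <-> filt0 F k (a - b).
Proof.
split=> [e|ab].
  have : sbcoset k a a by exists 0; [exact: filt0_0|rewrite addr0].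
  by rewrite e => -[x Fx <-]; rewrite addrC addKr.
apply/seteqP; split=> _ [x Fx <-].
  by exists (a - b + x); [exact: filt0D|ring].
by exists (x - (a - b)); [apply: filt0D => //; exact: filt0N|ring].
Qed.

(* The underlying type of the algebra of symbols: the elements of the direct
   sum of the quotients A^(k) / A^(k)_0 are the families of cosets, almost all
   of which are zero. *)
Record symbols := Symbols {
  component : nat -> set A;
  component_coset :
    forall k, exists2 a : A, F k a & component k = sbcoset k a;
  component_finite :
    exists K : nat, forall k, (K <= k)%N -> component k = sbcoset k 0
}.

HB.instance Definition _ := gen_eqMixin symbols.
HB.instance Definition _ := gen_choiceMixin symbols.

Lemma symbols_eq (X Y : symbols) : component X = component Y -> X = Y.
Proof.
case: X Y => [X X1 X2] [Y Y1 Y2] /= e; rewrite e in X1 X2 *.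
by congr Symbols; exact: Prop_irrelevance.
Qed.

Record good_family (a : nat -> A) : Prop := GoodFamily {
  good_filt : forall k, F k (a k);
  good_finite : exists K : nat, forall k, (K <= k)%N -> filt0 F k (a k)
}.

Lemma symb_of_coset (a : nat -> A) (ga : good_family a) :
  forall k, exists2 b : A, F k b & sbcoset k (a k) = sbcoset k b.
Proof. by move=> k; exists (a k) => //; exact: good_filt. Qed.

Lemma symb_of_finite (a : nat -> A) (ga : good_family a) :
  exists K : nat, forall k, (K <= k)%N -> sbcoset k (a k) = sbcoset k 0.
Proof.
by case: ga => _ [K aK]; exists K => k /aK ak; apply/sbcosetP; rewrite subr0.
Qed.

Definition symb_of (a : nat -> A) (ga : good_family a) : symbols :=
  Symbols (symb_of_coset ga) (symb_of_finite ga).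

Lemma symb_of_eq a b (ga : good_family a) (gb : good_family b) :
  symb_of ga = symb_of gb <-> forall k, filt0 F k (a k - b k).
Proof.
split=> [[e] k|ab]; first by apply/sbcosetP; have := congr1 (@^~ k) e.
by apply: symbols_eq; apply/funext => k /=; exact/sbcosetP.
Qed.

Definition srepr (X : symbols) (k : nat) : A :=
  s2val (cid2 (component_coset X k)).

Lemma component_srepr X k : component X k = sbcoset k (srepr X k).
Proof. exact: (s2valP' (cid2 (component_coset X k))). Qed.

Lemma good_srepr X : good_family (srepr X).
Proof.
split=> [k|]; first exact: (s2valP (cid2 (component_coset X k))).
have [K XK] := component_finite X; exists K => k /XK.
by rewrite component_srepr => /sbcosetP; rewrite subr0.
Qed.

Lemma sreprK X : symb_of (good_srepr X) = X.
Proof.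
by apply: symbols_eq; apply/funext => k /=; rewrite -component_srepr.
Qed.

Lemma srepr_symb_of a (ga : good_family a) k :
  filt0 F k (srepr (symb_of ga) k - a k).
Proof. by apply/sbcosetP; rewrite -component_srepr. Qed.

Lemma good0 : good_family (fun=> 0).
Proof. by split=> [k|]; [exact: filt_0|exists 0%N => k _; exact: filt0_0]. Qed.

Lemma good_hom k a : F k a -> good_family (fun n => if n == k then a else 0).
Proof.
move=> Fa; split=> [n|]; first by case: eqP => [->//|_]; exact: filt_0.
by exists k.+1 => n kn; rewrite gtn_eqF//; exact: filt0_0.
Qed.

Lemma goodN a : good_family a -> good_family (fun k => - a k).
Proof.
move=> [aF [K a0]]; split=> [k|]; first exact: filtN.
by exists K => k /a0; exact: filt0N.
Qed.

Lemma goodD a b :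
  good_family a -> good_family b -> good_family (fun k => a k + b k).
Proof.
move=> [aF [K a0]] [bF [L b0]]; split=> [k|]; first exact: filtD.
exists (maxn K L) => k; rewrite geq_max => /andP[/a0 ? /b0 ?].
exact: filt0D.
Qed.

Lemma goodZ (r : R) a : good_family a -> good_family (fun k => r *: a k).
Proof.
move=> [aF [K a0]]; split=> [k|]; first exact: filtZ.
by exists K => k /a0; exact: filt0Z.
Qed.

Definition conv (a b : nat -> A) (n : nat) : A :=
  \sum_(i < n.+1) a i * b (n - i)%N.

Lemma good_conv a b :
  good_family a -> good_family b -> good_family (conv a b).
Proof.
move=> [aF [K a0]] [bF [L b0]]; split=> [n|].
  apply: filt_sum => i _; have /subnKC e : (i <= n)%N by rewrite -ltnS.
  by have := filtM (aF i) (bF (n - i)%N); rewrite e.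
exists (K + L)%N => n KLn; apply: filt0_sum => i _.
have /subnKC e : (i <= n)%N by rewrite -ltnS.
have [/a0 ai|iK] := leqP K i.
  by have := filt0Ml ai (bF (n - i)%N); rewrite e.
have /b0 bi : (L <= n - i)%N by lia.
by have := filt0Mr (aF i) bi; rewrite e.
Qed.

Lemma conv_congr a a' b b' : good_family a -> good_family b' ->
  (forall k, filt0 F k (a k - a' k)) -> (forall k, filt0 F k (b k - b' k)) ->
  forall n, filt0 F n (conv a b n - conv a' b' n).
Proof.
move=> ga gb aa bb n; rewrite /conv -sumrB; apply: filt0_sum => i _.
have -> : a i * b (n - i)%N - a' i * b' (n - i)%N =
  a i * (b (n - i)%N - b' (n - i)%N) + (a i - a' i) * b' (n - i)%N.
  by rewrite mulrBr mulrBl addrA subrK.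
have /subnKC e : (i <= n)%N by rewrite -ltnS.
apply: filt0D.
  by have := filt0Mr (good_filt ga i) (bb (n - i)%N); rewrite e.
by have := filt0Ml (aa i) (good_filt gb (n - i)%N); rewrite e.
Qed.

Lemma convC a b n : conv a b n = conv b a n.
Proof.
rewrite /conv (reindex_inj rev_ord_inj)/=; apply: eq_bigr => i _.
have i_n : (i <= n)%N by rewrite -ltnS.
by rewrite subSS subKn// mulrC.
Qed.

Lemma conv_coef a b N n : (n < N)%N ->
  conv a b n = ((\poly_(i < N) a i) * (\poly_(i < N) b i))`_n.
Proof.
move=> nN; rewrite coefM /conv; apply: eq_bigr => i _.
have i_n : (i <= n)%N by rewrite -ltnS.
have iN : (i < N)%N by exact: leq_ltn_trans nN.
have niN : (n - i < N)%N by exact: leq_ltn_trans (leq_subr _ _) nN.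
by rewrite !coef_poly iN niN.
Qed.

Lemma convA a b c n : conv a (conv b c) n = conv (conv a b) c n.
Proof.
pose P (x : nat -> A) := \poly_(i < n.+1) x i.
transitivity ((P a * (P b * P c))`_n).
  rewrite coefM {1}/conv; apply: eq_bigr => i _; have := ltn_ord i => i_n.
  by rewrite coef_poly i_n (@conv_coef _ _ n.+1)// ltnS leq_subr.
rewrite -[RHS]/(\sum_(i < n.+1) conv a b i * c (n - i)%N) mulrA coefM.
apply: eq_bigr => i _; have := ltn_ord i => i_n.
by rewrite coef_poly ltnS leq_subr (@conv_coef _ _ n.+1).
Qed.

Definition sb_zero : symbols := symb_of good0.
Definition sb_opp (X : symbols) : symbols := symb_of (goodN (good_srepr X)).
Definition sb_add (X Y : symbols) : symbols :=
  symb_of (goodD (good_srepr X) (good_srepr Y)).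
Definition sb_scale (r : R) (X : symbols) : symbols :=
  symb_of (goodZ r (good_srepr X)).
Definition sb_one : symbols := symb_of (good_hom (filt1 F)).
Definition sb_mul (X Y : symbols) : symbols :=
  symb_of (good_conv (good_srepr X) (good_srepr Y)).

Lemma symbP (P : symbols -> Prop) :
  (forall a (ga : good_family a), P (symb_of ga)) -> forall X, P X.
Proof. by move=> PP X; rewrite -(sreprK X). Qed.

Lemma sb_oppE a (ga : good_family a) :
  sb_opp (symb_of ga) = symb_of (goodN ga).
Proof.
apply/symb_of_eq => k; rewrite -opprD; apply: filt0N.
exact: srepr_symb_of.
Qed.

Lemma sb_addE a b (ga : good_family a) (gb : good_family b) :
  sb_add (symb_of ga) (symb_of gb) = symb_of (goodD ga gb).
Proof.
apply/symb_of_eq => k; rewrite opprD addrACA.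
by apply: filt0D; exact: srepr_symb_of.
Qed.

Lemma sb_scaleE r a (ga : good_family a) :
  sb_scale r (symb_of ga) = symb_of (goodZ r ga).
Proof.
by apply/symb_of_eq => k; rewrite -scalerBr; apply: filt0Z; exact: srepr_symb_of.
Qed.

Lemma sb_mulE a b (ga : good_family a) (gb : good_family b) :
  sb_mul (symb_of ga) (symb_of gb) = symb_of (good_conv ga gb).
Proof.
apply/symb_of_eq; apply: conv_congr => //; first exact: good_srepr.
  exact: srepr_symb_of.
exact: srepr_symb_of.
Qed.

Lemma symb_of_ext a b (ga : good_family a) (gb : good_family b) :
  a =1 b -> symb_of ga = symb_of gb.
Proof. by move=> e; apply/symb_of_eq => k; rewrite e subrr; exact: filt0_0. Qed.

Definition sbE := (sb_addE, sb_oppE, sb_scaleE, sb_mulE).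

Lemma sb_addA : associative sb_add.
Proof.
elim/symbP => a ga; elim/symbP => b gb; elim/symbP => c gc.
by rewrite !sbE; apply: symb_of_ext => k; rewrite addrA.
Qed.

Lemma sb_addC : commutative sb_add.
Proof.
elim/symbP => a ga; elim/symbP => b gb.
by rewrite !sbE; apply: symb_of_ext => k; rewrite addrC.
Qed.

Lemma sb_add0 : left_id sb_zero sb_add.
Proof.
by elim/symbP => a ga; rewrite !sbE; apply: symb_of_ext => k; rewrite add0r.
Qed.

Lemma sb_addN : left_inverse sb_zero sb_opp sb_add.
Proof.
by elim/symbP => a ga; rewrite !sbE; apply: symb_of_ext => k; rewrite addNr.
Qed.

HB.instance Definition _ :=
  GRing.isZmodule.Build symbols sb_addA sb_addC sb_add0 sb_addN.

Lemma sb_mulA : associative sb_mul.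
Proof.
elim/symbP => a ga; elim/symbP => b gb; elim/symbP => c gc.
by rewrite !sbE; apply: symb_of_ext => k; rewrite convA.
Qed.

Lemma sb_mulC : commutative sb_mul.
Proof.
elim/symbP => a ga; elim/symbP => b gb.
by rewrite !sbE; apply: symb_of_ext => k; rewrite convC.
Qed.

Lemma sb_mul1 : left_id sb_one sb_mul.
Proof.
elim/symbP => a ga; rewrite !sbE; apply: symb_of_ext => k.
rewrite /conv big_ord_recl/= subn0 mul1r big1 ?addr0// => i _.
by rewrite /= mul0r.
Qed.

Lemma sb_mulDl : left_distributive sb_mul sb_add.
Proof.
elim/symbP => a ga; elim/symbP => b gb; elim/symbP => c gc.
rewrite !sbE; apply: symb_of_ext => k.
by rewrite /conv -big_split; apply: eq_bigr => i _; rewrite mulrDl.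
Qed.

Lemma sb_one_neq0 : sb_one != sb_zero.
Proof.
apply/eqP => /symb_of_eq /(_ 0%N); rewrite /= subr0 => /eqP.
by rewrite oner_eq0.
Qed.

HB.instance Definition _ := GRing.Zmodule_isComNzRing.Build symbols
  sb_mulA sb_mulC sb_mul1 sb_mulDl sb_one_neq0.

Lemma sb_scaleA r t X : sb_scale r (sb_scale t X) = sb_scale (r * t) X.
Proof.
elim/symbP: X => a ga; rewrite !sbE.
by apply: symb_of_ext => k; rewrite scalerA.
Qed.

Lemma sb_scale1 : left_id 1 sb_scale.
Proof.
by elim/symbP => a ga; rewrite !sbE; apply: symb_of_ext => k; rewrite scale1r.
Qed.

Lemma sb_scaleDr : right_distributive sb_scale +%R.
Proof.
move=> r; elim/symbP => a ga; elim/symbP => b gb.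
rewrite /GRing.add/= !sbE.
by apply: symb_of_ext => k; rewrite scalerDr.
Qed.

Lemma sb_scaleDl X : {morph sb_scale^~ X : r t / r + t}.
Proof.
move=> r t; elim/symbP: X => a ga; rewrite [RHS]/GRing.add/= !sbE.
by apply: symb_of_ext => k; rewrite scalerDl.
Qed.

HB.instance Definition _ := GRing.Zmodule_isLmodule.Build R symbols
  sb_scaleA sb_scale1 sb_scaleDr sb_scaleDl.

Lemma sb_scaleAl (r : R) (X Y : symbols) : r *: (X * Y) = (r *: X) * Y.
Proof.
elim/symbP: X => a ga; elim/symbP: Y => b gb.
rewrite /GRing.scale/= /GRing.mul/= !sbE; apply: symb_of_ext => k.
by rewrite /conv scaler_sumr; apply: eq_bigr => i _; rewrite scalerAl.
Qed.

HB.instance Definition _ := GRing.Lmodule_isLalgebra.Build R symbols sb_scaleAl.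

Lemma sb_scaleAr (r : R) (X Y : symbols) : r *: (X * Y) = X * (r *: Y).
Proof. by rewrite mulrC scalerAl mulrC. Qed.

HB.instance Definition _ := GRing.Lalgebra_isAlgebra.Build R symbols sb_scaleAr.

(* The symbol [a]^{k-sb}, as an element of the algebra of symbols, for a in
   A^(k); the value 0 for the other a is a convention. *)
Definition sb (k : nat) (a : A) : symbols :=
  match pselect (F k a) with
  | left Fa => symb_of (good_hom Fa)
  | right _ => 0
  end.

Lemma sbT k a (Fa : F k a) : sb k a = symb_of (good_hom Fa).
Proof.
by rewrite /sb; case: pselect => // Fa'; exact: symb_of_ext.
Qed.

Lemma component_sb k a n : F k a ->
  component (sb k a) n = sbcoset n (if n == k then a else 0).
Proof. by move=> Fa; rewrite (sbT Fa). Qed.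

Lemma sb_eq0 k a : F k a -> sb k a = 0 <-> filt0 F k a.
Proof.
move=> Fa; rewrite (sbT Fa); split=> [/symb_of_eq /(_ k)|a0].
  by rewrite eqxx subr0.
apply/symb_of_eq => n; rewrite subr0.
by case: eqP => [->//|_]; exact: filt0_0.
Qed.

Lemma sb1 : sb 0 1 = 1.
Proof. by rewrite (sbT (filt1 F)). Qed.

Lemma sbD k a b : F k a -> F k b -> sb k (a + b) = sb k a + sb k b.
Proof.
move=> Fa Fb; rewrite (sbT Fa) (sbT Fb) (sbT (filtD Fa Fb)).
rewrite /GRing.add/= sbE; apply: symb_of_ext => n.
by case: eqP => //; rewrite addr0.
Qed.

Lemma sbZ k (r : R) a : F k a -> sb k (r *: a) = r *: sb k a.
Proof.
move=> Fa; rewrite (sbT Fa) (sbT (filtZ r Fa)).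
rewrite /GRing.scale/= sbE; apply: symb_of_ext => n.
by case: eqP => //; rewrite scaler0.
Qed.

Lemma sbM k l a b : F k a -> F l b -> sb k a * sb l b = sb (k + l) (a * b).
Proof.
move=> Fa Fb; rewrite (sbT Fa) (sbT Fb) (sbT (filtM Fa Fb)).
rewrite /GRing.mul/= sbE; apply: symb_of_ext => n; rewrite /conv.
have [kn|nk] := ltnP k n.+1; last first.
  rewrite big1 => [|i _]; first by case: eqP => // e; lia.
  by rewrite ltn_eqF ?mul0r//; exact: leq_trans nk.
rewrite (bigD1 (Ordinal kn))//= eqxx big1 ?addr0 => [|i ik]; last first.
  by rewrite -val_eqE/= in ik; rewrite (negPf ik) mul0r.
have -> : (n - k == l)%N = (n == k + l)%N by apply/eqP/eqP; lia.
by case: eqP => //; rewrite mulr0.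
Qed.

Lemma component_sum_sb K (a : nat -> A) n : (forall k, F k (a k)) ->
  component (\sum_(k < K) sb k (a k)) n =
  sbcoset n (if (n < K)%N then a n else 0).
Proof.
move=> Fa.
have g : good_family (fun n => if (n < K)%N then a n else 0).
  split=> [k|]; first by case: ifP => _ //; exact: filt_0.
  by exists K => k Kk; rewrite ltnNge Kk; exact: filt0_0.
suff -> : \sum_(k < K) sb k (a k) = symb_of g by [].
elim: K g => [|K IH] g; first by rewrite big_ord0; exact: symb_of_ext.
have g' : good_family (fun n => if (n < K)%N then a n else 0).
  split=> [k|]; first by case: ifP => _ //; exact: filt_0.
  by exists K => k Kk; rewrite ltnNge Kk; exact: filt0_0.
rewrite big_ord_recr/= (IH g') (sbT (Fa K)) [LHS]/GRing.add/= sbE.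
apply: symb_of_ext => k; rewrite ltnS.
by case: ltngtP => [||->]; rewrite ?addr0 ?add0r.
Qed.

Lemma symbols_decomp (X : symbols) : exists (K : nat) (a : nat -> A),
  (forall k, F k (a k)) /\ X = \sum_(k < K) sb k (a k).
Proof.
have [K XK] := component_finite X; have [Fr _] := good_srepr X.
exists K, (srepr X); split => //; apply: symbols_eq; apply/funext => n.
rewrite component_sum_sb//; case: ltnP => [_|/XK//].
exact: component_srepr.
Qed.

Definition cone_sb (C : set A) : set symbols :=
  [set X | exists (K : nat) (c : nat -> A),
    (forall k, (k <= K)%N -> C (c k) /\ F k (c k)) /\
    X = \sum_(0 <= k < K.+1) sb k (c k)].

End Filtration.

Arguments sb {R A} F k a.

(* Main.v *)
Require Import Defs.
From HB Require Import structures.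
From mathcomp Require Import all_boot all_order all_algebra.
From mathcomp Require Import boolp classical_sets reals.
From mathcomp Require Import zify ring lra.

Set Implicit Arguments.
Unset Strict Implicit.
Unset Printing Implicit Defensive.

Import Order.TTheory GRing.Theory Num.Theory.
Local Open Scope classical_set_scope.
Local Open Scope ring_scope.

(** Let B be the algebra of fractions x / s^k with x in F k; a character of B is
    a family of functionals alpha k : x |-> alpha (x / s^k) on the F k.
    Compatibility of s says that the fractions t / s^k with t in S and F k form
    an archimedean semiring of B, and C induces a module over it.  The theorem
    is the strict Positivstellensatz for this module, once the characters of B
    are recognized.  The number u := alpha 1 1, the value at 1 / s, decides
    between two kinds of characters.
    - If u != 0, then x |-> alpha k x / u^k does not depend on the k with x in
      F k, and is a character of A ([exists_character_algebra]).
    - If u = 0, then alpha k kills F (k - 1).  If x^m lies in F (k m - 1), then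
      (alpha k x)^m = 0, so alpha k kills the kernel of the k-symbol and the
      alpha k add up to a character of the algebra of symbols with value 1 on
      the symbol of s ([exists_character_symbols]).

    The fractions are never formed: a fraction is a pair (k, x) with x in F k,
    a subset of B is a family M : nat -> set A, and the identification of (k, x)
    with (k + 1, s x) becomes the saturation axiom of [graded_module].

    For the implication from positivity on the characters to the certificate,
    adjoin (k, - a) to the graded module of C.  If the result does not contain
    -1, then it lies in a maximal proper one by Zorn's lemma.  Maximality forces
    each x or - x to belong to it ([gm_maximal_total]), so that B is totally
    preordered with order unit 1.  The infinitesimals form an ideal, and every
    element differs from a unique scalar by an infinitesimal; this scalar is a
    character ([exists_graded_character]).  It is nonnegative on C and on - a,
    against the hypothesis.  If the result contains -1, there is a t in S with
    t a - s^(i + k) in C, and a descent on the constant r in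
    s^p a + r s^(p + k) in C turns this into the certificate
    ([strict_certificate]).

    Conversely, a character is positive on s, or has value 1 on the symbol of s,
    so that it can be applied to the certificate and divided by the powers
    of s. *)

(** * Auxiliary facts *)

Lemma scale_in_alg (R : realType) (A : comAlgType R) (r : R) (x : A) :
  r *: x = in_alg A r * x.
Proof. by rewrite mulr_algl. Qed.

Ltac alg_ring := rewrite ?(exprS, exprD) ?scale_in_alg; ring.

Lemma exists_lrmorphism (R : realType) (B : comAlgType R) (f : B -> R) :
  (forall (r : R) x y, f (r *: x + y) = r * f x + f y) ->
  (forall x y, f (x * y) = f x * f y) -> f 1 = 1 ->
  exists phi : {lrmorphism B -> R | *%R}, forall x, phi x = f x.
Proof.
move=> f_lin f_mul f_one.
pose f_isLinear := GRing.isLinear.Build R B R *%R f f_lin.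
pose f_isMonoid := GRing.isMonoidMorphism.Build B R f (conj f_one f_mul).
pose phi : {lrmorphism B -> R | *%R} := HB.pack f f_isLinear f_isMonoid.
by exists phi.
Qed.

Lemma sum_ord_support (V : nmodType) (f : nat -> V) N N' :
  (forall k, (N <= k)%N -> f k = 0) -> (forall k, (N' <= k)%N -> f k = 0) ->
  \sum_(k < N) f k = \sum_(k < N') f k.
Proof.
have le_case p q : (p <= q)%N -> (forall k, (p <= k)%N -> f k = 0) ->
    \sum_(k < p) f k = \sum_(k < q) f k.
  move=> pq fp; rewrite -!(big_mkord xpredT f) [RHS](big_cat_nat (leq0n p) pq)//=.
  by rewrite [X in _ = _ + X]big_nat [X in _ = _ + X]big1 ?addr0// => k /andP[/fp].
by move=> fN fN'; case/orP: (leq_total N N') => ?; [|symmetry]; exact: le_case.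
Qed.

Section Semiring.
Variables (R : realType) (A : comAlgType R) (S : set A).
Hypothesis S_semiring : cone_semiring S.

Lemma semiringD x y : S x -> S y -> S (x + y).
Proof. by case: S_semiring => -[_ SD _] _ _; exact: SD. Qed.

Lemma semiringZ (r : R) x : 0 <= r -> S x -> S (r *: x).
Proof. by case: S_semiring => -[_ _ SZ] _ _; exact: SZ. Qed.

Lemma semiring1 : S 1. Proof. by case: S_semiring. Qed.

Lemma semiringM x y : S x -> S y -> S (x * y).
Proof. by case: S_semiring => _ _; apply. Qed.

Lemma semiring0 : S 0.
Proof. by rewrite -(scale0r 1); apply: semiringZ => //; exact: semiring1. Qed.

Lemma semiring_alg (r : R) : 0 <= r -> S r%:A.
Proof. by move=> r0; apply: semiringZ => //; exact: semiring1. Qed.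

Lemma semiringX x n : S x -> S (x ^+ n).
Proof.
move=> Sx; elim: n => [|n IH]; first by rewrite expr0; exact: semiring1.
by rewrite exprS; exact: semiringM.
Qed.

Variable C : set A.
Hypothesis C_module : cone_module S C.

Lemma semiring_sub_module x : S x -> C x.
Proof. by case: C_module => _ C1 SC Sx; rewrite -[x]mulr1; exact: SC. Qed.

End Semiring.

Section GradedModules.
Variables (R : realType) (A : comAlgType R) (F : filtration A).
Variables (S : set A) (s : A).
Hypothesis S_semiring : cone_semiring S.
Hypothesis s_compatible : compatible F S s.

Lemma compatible_semiring : S s.
Proof.
case: s_compatible => -[t St <-] _ _; apply: (semiringD S_semiring) => //.
exact: semiring1.
Qed.

Lemma compatible_filt : F 1%N s. Proof. by case: s_compatible. Qed.

Lemma compatible_filtX n : F n (s ^+ n).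
Proof. by have := filtX n compatible_filt; rewrite mul1n. Qed.

Lemma compatible_semiringX n : S (s ^+ n).
Proof. by apply: semiringX => //; exact: compatible_semiring. Qed.

Lemma compatible_order_unit k x : F k x -> exists2 lambda : R, 0 < lambda &
  S (lambda *: s ^+ k - x) /\ F k (lambda *: s ^+ k - x).
Proof.
move=> Fx; have [_ _ /(_ k x Fx)[lambda lambda0 Sx]] := s_compatible.
exists lambda => //; split => //.
by apply: filtD; [apply: filtZ; exact: compatible_filtX|exact: filtN].
Qed.

(** * Graded modules *)

(** The submodule { x / s^k | M k x } of the algebra of fractions.  The last
    axiom says that x / s^k = (s x) / s^(k + 1); the inclusion of s M k in
    M (k + 1) follows from the third. *)
Record graded_module (M : nat -> set A) : Prop := GradedModule {
  gm_filt : forall k x, M k x -> F k x;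
  gmD : forall k x y, M k x -> M k y -> M k (x + y);
  gmM : forall l k t x, S t -> F l t -> M k x -> M (l + k)%N (t * x);
  gm1 : M 0%N 1;
  gm_saturated : forall k x, F k x -> M k.+1 (s * x) -> M k x
}.

Definition proper (M : nat -> set A) := ~ M 0%N (- 1).

Section GradedModuleTheory.
Variable M : nat -> set A.
Hypothesis gM : graded_module M.

Lemma gm_semiring l t : S t -> F l t -> M l t.
Proof.
by move=> St Ft; have := gmM gM St Ft (gm1 gM); rewrite addn0 mulr1.
Qed.

Lemma gmZ k (r : R) x : 0 <= r -> M k x -> M k (r *: x).
Proof.
move=> r0 Mx; rewrite -mulr_algl -[k]add0n; apply: gmM => //.
  exact: semiring_alg.
by apply: filtZ; exact: filt1.
Qed.

Lemma gm_Xs n k x : M k x -> M (n + k)%N (s ^+ n * x).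
Proof.
apply: gmM => //; [exact: compatible_semiringX|exact: compatible_filtX].
Qed.

Lemma gm_saturatedX n k x : F k x -> M (n + k)%N (s ^+ n * x) -> M k x.
Proof.
move=> Fx; elim: n => [|n IH]; first by rewrite expr0 mul1r.
rewrite exprS -mulrA addSn => Mx; apply: IH; apply: gm_saturated => //.
apply: filtM => //; exact: compatible_filtX.
Qed.

Lemma proper_scaled k (r : R) : proper M -> M k (r *: s ^+ k) -> 0 <= r.
Proof.
move=> pM Mr; rewrite leNgt; apply/negP => r0; apply: pM.
apply: (@gm_saturatedX k); first by apply: filtN; exact: filt1.
rewrite addn0 mulrN1 -scaleN1r.
have -> : -1 = (- r)^-1 * r by rewrite invrN mulNr mulVf// lt_eqF.
by rewrite -scalerA; apply: gmZ => //; rewrite invr_ge0 oppr_ge0 ltW.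
Qed.

(** The submodule generated by M and the fraction a / s^j.  The shift l brings
    x / s^n to a denominator for which it is a sum m + t a of numerators. *)
Definition gm_adjoin (j : nat) (a : A) (n : nat) : set A :=
  [set x | F n x /\ exists l i m t,
    [/\ (l + n = i + j)%N, M (l + n)%N m, S t, F i t
      & s ^+ l * x = m + t * a]].

Lemma gm_adjoin_graded j a : F j a -> graded_module (gm_adjoin j a).
Proof.
move=> Fa; split.
- by move=> k x [].
- move=> k x y [Fx [l [i [m [t [e Mm St Ft ex]]]]]].
  move=> [Fy [l' [i' [m' [t' [e' Mm' St' Ft' ey]]]]]].
  split; first exact: filtD.
  exists (l' + l)%N, (l' + i)%N, (s ^+ l' * m + s ^+ l * m').
  exists (s ^+ l' * t + s ^+ l * t'); split.
  + by lia.
  + apply: gmD => //; first by rewrite -addnA; exact: gm_Xs.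
    by rewrite [(l' + l)%N]addnC -addnA; exact: gm_Xs.
  + apply: semiringD => //; apply: semiringM => //; exact: compatible_semiringX.
  + apply: filtD; first by apply: filtM => //; exact: compatible_filtX.
    have -> : (l' + i = l + i')%N by lia.
    by apply: filtM => //; exact: compatible_filtX.
  + transitivity (s ^+ l' * (s ^+ l * x) + s ^+ l * (s ^+ l' * y)).
      by alg_ring.
    by rewrite ex ey; ring.
- move=> p k u x Su Fu [Fx [l [i [m [t [e Mm St Ft ex]]]]]].
  split; first exact: filtM.
  exists l, (p + i)%N, (u * m), (u * t); split.
  + by lia.
  + by rewrite addnCA; exact: gmM.
  + exact: semiringM.
  + exact: filtM.
  + by rewrite mulrCA ex; ring.
- split; first exact: filt1.
  exists j, 0%N, (s ^+ j), 0; split.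
  + by rewrite addn0.
  + apply: gm_semiring; rewrite ?addn0; first exact: compatible_semiringX.
    exact: compatible_filtX.
  + exact: semiring0.
  + exact: filt_0.
  + by rewrite mulr1 mul0r addr0.
- move=> k x Fx [_ [l [i [m [t [e Mm St Ft ex]]]]]]; split=> //.
  exists l.+1, i, m, t; split => //; rewrite ?addSnnS//.
  by rewrite -ex exprSr mulrA.
Qed.

Lemma gm_sub_adjoin j a k : M k `<=` gm_adjoin j a k.
Proof.
move=> x Mx; split; first exact: (gm_filt gM).
exists j, k, (s ^+ j * x), 0; split.
- by rewrite addnC.
- exact: gm_Xs.
- exact: semiring0.
- exact: filt_0.
- by rewrite mul0r addr0.
Qed.

Lemma gm_adjoin_mem j a : F j a -> gm_adjoin j a j a.
Proof.
move=> Fa; split=> //; exists 0%N, 0%N, 0, 1; split.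
- by [].
- apply: gm_semiring; [exact: semiring0|exact: filt_0].
- exact: semiring1.
- exact: filt1.
- by rewrite expr0 add0r.
Qed.

End GradedModuleTheory.

(** * Maximal proper graded modules *)

Definition gm_maximal (M : nat -> set A) :=
  forall N, graded_module N -> proper N ->
    (forall k, M k `<=` N k) -> forall k, N k `<=` M k.

Lemma exists_gm_maximal M0 : graded_module M0 -> proper M0 ->
  exists M, [/\ graded_module M, proper M, gm_maximal M
              & forall k, M0 k `<=` M k].
Proof.
move=> gM0 pM0.
pose good M := [/\ graded_module M, proper M & forall k, M0 k `<=` M k].
have good0 : good M0 by split => // k x.
pose T := {M : nat -> set A | good M}.
pose le (M N : T) := `[< forall k, sval M k `<=` sval N k >].
have [M Mmax] : exists t : T, premaximal le t.
  apply: (@ZL_preorder T (exist _ M0 good0)) => [t|r t u|Ch tot].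
  - by apply/asboolP => k x.
  - by move=> /asboolP rt /asboolP tu; apply/asboolP => k x /rt /tu.
  - have [[N0 ChN0]|noN] := pselect (exists N, Ch N); last first.
      by exists (exist _ M0 good0) => N ChN; case: noN; exists N.
    pose U k := [set x | exists2 N : T, Ch N & sval N k x].
    have both N N' : Ch N -> Ch N' -> exists P : T, [/\ Ch P,
        (forall k, sval N k `<=` sval P k) & (forall k, sval N' k `<=` sval P k)].
      move=> ChN ChN'; have [/asboolP le1|/asboolP le1] := tot _ _ ChN ChN'.
        by exists N'; split => // k x.
      by exists N; split => // k x.
    have gU : good U.
      split.
      + split.
        * by move=> k x [N _ Nx]; case: (svalP N) => gN _ _; exact: (gm_filt gN).
        * move=> k x y [N ChN Nx] [N' ChN' Ny].
          have [P [ChP NP NP']] := both _ _ ChN ChN'.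
          exists P => //; case: (svalP P) => gP _ _.
          by apply: (gmD gP); [exact: NP|exact: NP'].
        * move=> l k t x St Ft [N ChN Nx]; exists N => //.
          by case: (svalP N) => gN _ _; exact: (gmM gN).
        * by exists N0 => //; case: (svalP N0) => gN _ _; exact: (gm1 gN).
        * move=> k x Fx [N ChN Nx]; exists N => //.
          by case: (svalP N) => gN _ _; exact: (gm_saturated gN).
      + by move=> [N ChN]; case: (svalP N) => _ pN _; exact: pN.
      + by move=> k x M0x; exists N0 => //; case: (svalP N0) => _ _; exact.
    by exists (exist _ U gU) => N ChN; apply/asboolP => k x Nx; exists N.
have [gM pM M0M] := svalP M; exists (sval M); split => //.
move=> N gN pN MN.
have gN' : good N by split => // k x /M0M /MN.
have /(_ _)/asboolP := Mmax (exist _ N gN'); apply.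
by apply/asboolP.
Qed.

(** If neither a nor - a belongs to M, then -1 = m + t a and -1 = m' - t' a up
    to denominators, by maximality.  Multiplying by t' and t and adding
    eliminates a and gives, up to powers of s, - (t + t') in M, so that t is in
    the support of M.  The support is an ideal, since S - S is everything in
    each degree; hence t a is in M and -1 = m + t a too. *)
Lemma gm_maximal_total M j a : graded_module M -> proper M -> gm_maximal M ->
  F j a -> M j a \/ M j (- a).
Proof.
move=> gM pM maxM Fa; apply: contrapT => /not_orP[Na Nna].
have impr b : F j b -> ~ M j b -> gm_adjoin M j b 0%N (- 1).
  move=> Fb Nb; apply: contrapT => pN; apply: Nb.
  apply: (maxM (gm_adjoin M j b)) => //; last exact: gm_adjoin_mem.
    exact: gm_adjoin_graded.
  by move=> k; exact: gm_sub_adjoin.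
have [_ [l [i [m [t [e Mm St Ft ea]]]]]] := impr _ Fa Na.
have [_ [l' [i' [m' [t' [e' Mm' St' Ft' ea']]]]]] := impr _ (filtN Fa) Nna.
rewrite addn0 in e Mm; rewrite addn0 in e' Mm'.
have Mt : M i (- t).
  apply: (gm_saturatedX gM (n := l')) => //; first exact: filtN.
  have -> : s ^+ l' * - t = (t' * m + t * m') + s ^+ l * t'.
    have -> : m = s ^+ l * - 1 - t * a by rewrite ea; ring.
    have -> : m' = s ^+ l' * - 1 + t' * a by rewrite ea'; ring.
    by ring.
  have Mc : M (l' + i)%N (t' * m).
    have -> : (l' + i = i' + l)%N by lia.
    exact: gmM.
  have Mc' : M (l' + i)%N (t * m') by rewrite addnC; exact: gmM.
  apply: gmD => //; first exact: gmD.
  have -> : (l' + i = l + i')%N by lia.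
  by apply: gm_Xs => //; exact: gm_semiring.
(* t belongs to M and - M, hence so does every multiple of t. *)
have [lambda lambda0 []] := compatible_order_unit Fa.
set v := lambda *: s ^+ j - a => Sv Fv.
have Mta : M (i + j)%N (t * a).
  have -> : t * a = (lambda *: s ^+ j) * t + v * - t by rewrite /v; alg_ring.
  rewrite addnC; apply: gmD => //; apply: gmM => //.
  - by apply: semiringZ => //; [exact: ltW|exact: compatible_semiringX].
  - by apply: filtZ; exact: compatible_filtX.
  - exact: gm_semiring.
apply: pM; apply: (gm_saturatedX gM (n := l)) => //.
  by apply: filtN; exact: filt1.
by rewrite addn0 ea; apply: gmD => //; rewrite e.
Qed.

(** * The character of a maximal proper graded module *)

(** A character of the algebra of fractions, alpha k x being its value at
    x / s^k. *)
Record graded_character (alpha : nat -> A -> R) : Prop := GradedCharacter {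
  gc_linear : forall k (r : R) x y, F k x -> F k y ->
    alpha k (r *: x + y) = r * alpha k x + alpha k y;
  gcM : forall k l x y, F k x -> F l y ->
    alpha (k + l)%N (x * y) = alpha k x * alpha l y;
  gc1 : alpha 0%N 1 = 1;
  gc_s : alpha 1%N s = 1
}.

Section MaximalModule.
Variable M : nat -> set A.
Hypothesis gM : graded_module M.
Hypothesis pM : proper M.
Hypothesis M_max : gm_maximal M.

Definition infinitesimal (k : nat) : set A :=
  [set x | F k x /\ forall eps : R, 0 < eps ->
    M k (eps *: s ^+ k + x) /\ M k (eps *: s ^+ k - x)].

Lemma infinitesimalN k x : infinitesimal k x -> infinitesimal k (- x).
Proof.
move=> [Fx Nx]; split=> [|eps /Nx[]]; first exact: filtN.
by rewrite opprK.
Qed.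

Lemma infinitesimalD k x y :
  infinitesimal k x -> infinitesimal k y -> infinitesimal k (x + y).
Proof.
move=> [Fx Nx] [Fy Ny]; split=> [|eps eps0]; first exact: filtD.
have eps2 : 0 < eps / 2 by rewrite divr_gt0.
have [Nx1 Nx2] := Nx _ eps2; have [Ny1 Ny2] := Ny _ eps2.
have e : eps *: s ^+ k = (eps / 2) *: s ^+ k + (eps / 2) *: s ^+ k.
  by rewrite -scalerDl -splitr.
by rewrite e opprD; split; rewrite addrACA; exact: gmD.
Qed.

(** Multiplication by t in S preserves infinitesimals because t is bounded:
    if t <= lambda s^l, then eps - t x is the sum of (eps / lambda) (lambda - t)
    and t (eps / lambda - x). *)
Lemma infinitesimal_semiringM l k t x : S t -> F l t ->
  infinitesimal k x -> infinitesimal (l + k)%N (t * x).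
Proof.
move=> St Ft [Fx Nx]; split=> [|eps eps0]; first exact: filtM.
have [lambda lambda0 [Sv Fv]] := compatible_order_unit Ft.
have e0 : 0 < eps / lambda by rewrite divr_gt0.
have Mv : M (l + k)%N ((lambda *: s ^+ l - t) * ((eps / lambda) *: s ^+ k)).
  apply: gmM => //; apply: gmZ => //; first exact: ltW.
  by apply: gm_semiring => //;
    [exact: compatible_semiringX|exact: compatible_filtX].
have e : eps *: s ^+ (l + k) =
    (lambda *: s ^+ l - t) * ((eps / lambda) *: s ^+ k) +
    t * ((eps / lambda) *: s ^+ k).
  rewrite -mulrDl subrK -scalerAr -scalerAl scalerA.
  by rewrite divfK ?gt_eqF// -exprD.
have [Nx1 Nx2] := Nx _ e0.
rewrite e -!addrA -mulrDr -mulrBr.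
by split; apply: gmD => //; exact: gmM.
Qed.

(** In each degree, y is a difference of elements of S: lambda s^l minus
    lambda s^l - y. *)
Lemma infinitesimalM l k y x : F l y ->
  infinitesimal k x -> infinitesimal (l + k)%N (y * x).
Proof.
move=> Fy Nx.
have [lambda lambda0 [Sv Fv]] := compatible_order_unit Fy.
have -> : y * x = (lambda *: s ^+ l) * x + - ((lambda *: s ^+ l - y) * x).
  by alg_ring.
apply: infinitesimalD; last apply: infinitesimalN;
  apply: infinitesimal_semiringM => //.
- by apply: semiringZ => //; [exact: ltW|exact: compatible_semiringX].
- by apply: filtZ; exact: compatible_filtX.
Qed.

Lemma infinitesimalZ k (r : R) x :
  infinitesimal k x -> infinitesimal k (r *: x).
Proof.
move=> Nx; rewrite -mulr_algl -[k]add0n; apply: infinitesimalM => //.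
by apply: filtZ; exact: filt1.
Qed.

Lemma infinitesimal_scaled k (r : R) : infinitesimal k (r *: s ^+ k) -> r = 0.
Proof.
move=> [_ Nr]; apply/eqP; apply: contrapT => /negP r0.
have /Nr : 0 < `|r| / 2 by rewrite divr_gt0// normr_gt0.
rewrite -scalerDl -scalerBl => -[/(proper_scaled gM pM) r1].
move=> /(proper_scaled gM pM) r2.
have : 0 < `|r| by rewrite normr_gt0.
by case: (ler0P r) r1 r2 => ? ? ? ?; lra.
Qed.

(** The constant r is the cut that x defines in the total preorder of M: the
    supremum of the r below x, which exists since s^k is an order unit. *)
Lemma exists_value k x : F k x ->
  exists r : R, infinitesimal k (x - r *: s ^+ k).
Proof.
move=> Fx.
have order_unit y : F k y -> exists lambda : R, M k (lambda *: s ^+ k - y).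
  move=> /compatible_order_unit[lambda _ [Sy Fy]].
  by exists lambda; exact: gm_semiring.
pose E := [set r : R | M k (x - r *: s ^+ k)].
have supE : has_sup E.
  split.
    have [lambda My] := order_unit _ (filtN Fx); exists (- lambda).
    by rewrite /E/= scaleNr opprK addrC -[x]opprK.
  have [lambda My] := order_unit _ Fx; exists lambda => r Er.
  rewrite -subr_ge0; apply: (proper_scaled gM pM (k := k)).
  have -> : (lambda - r) *: s ^+ k = (lambda *: s ^+ k - x) + (x - r *: s ^+ k).
    by rewrite scalerBl addrA subrK.
  exact: gmD.
exists (sup E); split.
  by apply: filtD => //; apply: filtN; apply: filtZ; exact: compatible_filtX.
move=> eps eps0; split.
  have [r Er ltr] := sup_adherent eps0 supE.
  have -> : eps *: s ^+ k + (x - sup E *: s ^+ k) =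
      (x - r *: s ^+ k) + (r - (sup E - eps)) *: s ^+ k.
    by alg_ring.
  apply: gmD => //; apply: gmZ => //; first by rewrite subr_ge0 ltW.
  by apply: gm_semiring => //;
    [exact: compatible_semiringX|exact: compatible_filtX].
have : F k (x - (sup E + eps) *: s ^+ k).
  by apply: filtD => //; apply: filtN; apply: filtZ; exact: compatible_filtX.
move=> /(gm_maximal_total gM pM M_max)[Me|]; last first.
  by congr (M k _); alg_ring.
have := sup_upper_bound supE Me; lra.
Qed.

Definition value (k : nat) (x : A) : R :=
  xget 0 [set r | infinitesimal k (x - r *: s ^+ k)].

Lemma valueP k x : F k x -> infinitesimal k (x - value k x *: s ^+ k).
Proof.
by move=> /exists_value[r Nr]; rewrite /value; case: xgetP => [_ -> //|/(_ r)].
Qed.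

Lemma value_unique k x r : F k x -> infinitesimal k (x - r *: s ^+ k) ->
  value k x = r.
Proof.
move=> Fx Nr; apply/eqP; rewrite -subr_eq0; apply/eqP.
apply: (@infinitesimal_scaled k).
have -> : (value k x - r) *: s ^+ k =
    (x - r *: s ^+ k) + - (x - value k x *: s ^+ k).
  by alg_ring.
apply: infinitesimalD => //; apply: infinitesimalN; exact: valueP.
Qed.

(** The value is the quotient map modulo the infinitesimals, which form an
    ideal with quotient the real numbers. *)
Lemma value_graded_character : graded_character value.
Proof.
split.
- move=> k r x y Fx Fy; apply: value_unique; first exact: filt_lin.
  have -> : r *: x + y - (r * value k x + value k y) *: s ^+ k =
      r *: (x - value k x *: s ^+ k) + (y - value k y *: s ^+ k).
    by alg_ring.
  by apply: infinitesimalD; [apply: infinitesimalZ|]; exact: valueP.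
- move=> k l x y Fx Fy; apply: value_unique; first exact: filtM.
  have -> : x * y - (value k x * value l y) *: s ^+ (k + l) =
      y * (x - value k x *: s ^+ k) +
      (value k x *: s ^+ k) * (y - value l y *: s ^+ l).
    by alg_ring.
  apply: infinitesimalD.
    by rewrite addnC; apply: infinitesimalM => //; exact: valueP.
  apply: infinitesimalM; last exact: valueP.
  by apply: filtZ; exact: compatible_filtX.
- apply: value_unique; first exact: filt1.
  rewrite expr0 scale1r subrr -(scale0r (1 - value 0%N 1 *: s ^+ 0)).
  by apply: infinitesimalZ; apply: valueP; exact: filt1.
- apply: value_unique; first exact: compatible_filt.
  rewrite expr1 scale1r subrr -(scale0r (s - value 1%N s *: s ^+ 1)).
  by apply: infinitesimalZ; apply: valueP; exact: compatible_filt.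
Qed.

Lemma value_ge0 k x : M k x -> 0 <= value k x.
Proof.
move=> Mx; apply/ler_addgt0Pl => eps eps0.
have [_ /(_ _ eps0)[_ Nx]] := valueP (gm_filt gM Mx).
rewrite addrC; apply: (proper_scaled gM pM (k := k)).
have -> : (value k x + eps) *: s ^+ k =
    (eps *: s ^+ k - (x - value k x *: s ^+ k)) + x by alg_ring.
exact: gmD.
Qed.

End MaximalModule.

Lemma exists_graded_character M : graded_module M -> proper M ->
  exists alpha : nat -> A -> R,
    graded_character alpha /\ forall k x, M k x -> 0 <= alpha k x.
Proof.
move=> gM pM; have [N [gN pN N_max MN]] := exists_gm_maximal gM pM.
exists (value N); split; first exact: value_graded_character.
by move=> k x /MN; exact: value_ge0.
Qed.

(** * From graded characters to characters of the algebra and of its symbols *)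

Section CharactersOfGradedCharacters.
Variable alpha : nat -> A -> R.
Hypothesis gc : graded_character alpha.

Lemma gcZ k (r : R) x : F k x -> alpha k (r *: x) = r * alpha k x.
Proof.
move=> Fx; have a0 : alpha k 0 = 0.
  have := gc_linear gc (-1) Fx Fx.
  by rewrite scaleN1r addNr mulN1r addNr.
by have := gc_linear gc r Fx (filt_0 F k); rewrite addr0 a0 addr0.
Qed.

Lemma gcD k x y : F k x -> F k y -> alpha k (x + y) = alpha k x + alpha k y.
Proof. by move=> Fx Fy; have := gc_linear gc 1 Fx Fy; rewrite scale1r mul1r. Qed.

Lemma gc0 k : alpha k 0 = 0.
Proof. by have := gcZ 0 (filt_0 F k); rewrite scale0r mul0r. Qed.

Lemma gcB k x y : F k x -> F k y -> alpha k (x - y) = alpha k x - alpha k y.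
Proof.
move=> Fx Fy; rewrite -scaleN1r gcD ?gcZ ?mulN1r//.
exact: filtZ.
Qed.

Lemma gc_sum k I (r : seq I) (P : pred I) (f : I -> A) :
  (forall i, P i -> F k (f i)) ->
  alpha k (\sum_(i <- r | P i) f i) = \sum_(i <- r | P i) alpha k (f i).
Proof.
move=> Ff; elim: r => [|i r IH]; first by rewrite !big_nil gc0.
rewrite !big_cons; case: ifP => // Pi.
by rewrite gcD ?IH//; [exact: Ff|exact: filt_sum].
Qed.

Lemma gcX k x n : F k x -> alpha (k * n)%N (x ^+ n) = alpha k x ^+ n.
Proof.
move=> Fx; elim: n => [|n IH]; first by rewrite muln0 !expr0 gc1.
by rewrite mulnS !exprS (gcM gc) ?IH//; exact: filtX.
Qed.

(** Replacing the denominator s^k by s^(n + k) multiplies a fraction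
    by (1 / s)^n. *)
Lemma gc_raise k n x : F k x -> alpha (n + k)%N x = alpha 1%N 1 ^+ n * alpha k x.
Proof.
have F1 : F 1%N 1 by apply: (filtS (filt1 F)).
move=> Fx; rewrite -{1}[x]mul1r -[in LHS](expr1n _ n) -{1}[n]mul1n.
by rewrite (gcM gc) ?gcX//; exact: filtX.
Qed.

(** If u = alpha 1 1 is nonzero, the numbers alpha k x / u^k for the various k
    with x in F k agree, because both alpha k x / u^k and alpha l x / u^l equal
    alpha (k + l) x / u^(k + l). *)
Lemma exists_character_algebra : alpha 1%N 1 != 0 ->
  exists phi : {lrmorphism A -> R | *%R},
    forall k x, F k x -> alpha k x = alpha 1%N 1 ^+ k * phi x.
Proof.
set u := alpha 1%N 1 => u0.
have un0 n : u ^+ n != 0 by rewrite expf_neq0.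
have /choice[deg Fdeg] : forall x, exists k, F k x.
  move=> x; have : [set: A] x by [].
  by rewrite -(filt_cover F) => -[k _ Fx]; exists k.
pose f x := alpha (deg x) x / u ^+ deg x.
have fP k x : F k x -> alpha k x = u ^+ k * f x.
  move=> Fx; apply: (mulfI (un0 (deg x))).
  rewrite -gc_raise// addnC gc_raise; last exact: Fdeg.
  rewrite -/u /f mulrCA; congr (_ * _).
  by rewrite mulrCA divff ?mulr1.
have [|||phi phiE] := @exists_lrmorphism R A f.
- move=> r x y; have le1 := leq_maxl (deg x) (deg y).
  have le2 := leq_maxr (deg x) (deg y); move: (maxn _ _) le1 le2 => k le1 le2.
  have Fx := filt_le le1 (Fdeg x); have Fy := filt_le le2 (Fdeg y).
  apply: (mulfI (un0 k)); rewrite -fP; last exact: filt_lin.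
  by rewrite (gc_linear gc)// (fP _ _ Fx) (fP _ _ Fy); ring.
- move=> x y; apply: (mulfI (un0 (deg x + deg y)%N)).
  rewrite -fP; last exact: filtM.
  by rewrite (gcM gc)// (fP _ _ (Fdeg x)) (fP _ _ (Fdeg y)) exprD; ring.
- by have := fP _ _ (filt1 F); rewrite expr0 mul1r (gc1 gc).
by exists phi => k x Fx; rewrite phiE fP.
Qed.

(** The power x^m of an element of the kernel of the symbol map is killed
    because it has degree at most k m - 1 and alpha 1 1 = 0. *)
Lemma gc_filt0 k x : alpha 1%N 1 = 0 -> filt0 F k x -> alpha k x = 0.
Proof.
move=> u0; case: k => [->|k [Fx [m m0 Fxm]]]; first exact: gc0.
have e : (k.+1 * m = 1 + (k.+1 * m - 1))%N by lia.
have := gcX m Fx; rewrite e gc_raise// u0 expr1 mul0r => /esym/eqP.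
by rewrite expf_eq0 => /andP[_ /eqP].
Qed.

(** The functionals alpha k factor through the graded pieces of the algebra of
    symbols, and their sum is multiplicative: a product of symbols is a
    convolution, so its image is the product of the polynomials with
    coefficients alpha i (a i) and alpha i (b i), evaluated at 1. *)
Lemma exists_character_symbols : alpha 1%N 1 = 0 ->
  exists psi : {lrmorphism symbols F -> R | *%R},
    forall k x, F k x -> psi (sb F k x) = alpha k x.
Proof.
move=> u0.
have /choice[bound boundP] : forall X : symbols F, exists K, forall k,
    (K <= k)%N -> filt0 F k (srepr X k).
  by move=> X; case: (good_srepr X).
pose f (X : symbols F) := \sum_(k < bound X) alpha k (srepr X k).
have fE a (ga : good_family F a) N : (forall k, (N <= k)%N -> filt0 F k (a k)) ->
    f (symb_of ga) = \sum_(k < N) alpha k (a k).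
  move=> aN; have e k : alpha k (srepr (symb_of ga) k) = alpha k (a k).
    apply/eqP; rewrite -subr_eq0 -gcB; first last.
    - exact: good_filt.
    - exact: (good_filt (good_srepr _)).
    - by apply/eqP; apply: gc_filt0 => //; exact: srepr_symb_of.
  rewrite /f (eq_bigr (fun k : 'I__ => alpha k (a k)))//.
  apply: (@sum_ord_support R (fun k => alpha k (a k))) => k.
    by move=> /boundP; rewrite -e; exact: gc_filt0.
  by move=> /aN; exact: gc_filt0.
have [|||psi psiE] := @exists_lrmorphism R (symbols F) f.
- move=> r; elim/symbP => a ga; elim/symbP => b gb.
  have -> : r *: symb_of ga + symb_of gb = symb_of (goodD (goodZ r ga) gb).
    by rewrite /GRing.scale/GRing.add/= !sbE.
  have [K aK] := good_finite ga; have [L bL] := good_finite gb.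
  have aK' k : (maxn K L <= k)%N -> filt0 F k (a k).
    by rewrite geq_max => /andP[/aK].
  have bL' k : (maxn K L <= k)%N -> filt0 F k (b k).
    by rewrite geq_max => /andP[_ /bL].
  rewrite (fE _ _ _ aK') (fE _ _ _ bL') (fE _ _ (maxn K L)); last first.
    by move=> k kK; apply: filt0D; [apply: filt0Z; exact: aK'|exact: bL'].
  rewrite mulr_sumr -big_split; apply: eq_bigr => k _ /=.
  by apply: (gc_linear gc); exact: good_filt.
- elim/symbP => a ga; elim/symbP => b gb.
  have -> : symb_of ga * symb_of gb = symb_of (good_conv ga gb).
    by rewrite /GRing.mul/= !sbE.
  have [K aK] := good_finite ga; have [L bL] := good_finite gb.
  rewrite (fE _ _ _ aK) (fE _ _ _ bL) (fE _ _ (K + L)%N); last first.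
    move=> n nKL; apply: filt0_sum => i _.
    have i_n : (i <= n)%N by rewrite -ltnS.
    have [Ki|iK] := leqP K i.
      by have := filt0Ml (aK _ Ki) (good_filt gb (n - i)%N); rewrite subnKC.
    have Ln : (L <= n - i)%N by lia.
    by have := filt0Mr (good_filt ga i) (bL _ Ln); rewrite subnKC.
  pose P := \poly_(i < K) alpha i (a i); pose Q := \poly_(i < L) alpha i (b i).
  have PE i : P`_i = alpha i (a i).
    by rewrite coef_poly; case: ltnP => // /aK /(gc_filt0 u0).
  have QE i : Q`_i = alpha i (b i).
    by rewrite coef_poly; case: ltnP => // /bL /(gc_filt0 u0).
  have at1 (p : {poly R}) n : (size p <= n)%N -> p.[1] = \sum_(i < n) p`_i.
    move=> /horner_coef_wide ->; apply: eq_bigr => i _.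
    by rewrite expr1n mulr1.
  transitivity (P * Q).[1].
    rewrite (@at1 _ (K + L)%N); last first.
      apply: leq_trans (size_polyMleq _ _) _; apply: leq_trans (leq_pred _) _.
      by apply: leq_add; exact: size_poly.
    apply: eq_bigr => n _; rewrite coefM /conv gc_sum => [|i _]; last first.
      have /subnKC {1}<- : (i <= n)%N by rewrite -ltnS.
      by apply: filtM; exact: good_filt.
    apply: eq_bigr => i _; have /subnKC {1}<- : (i <= n)%N by rewrite -ltnS.
    by rewrite (gcM gc) ?PE ?QE//; exact: good_filt.
  rewrite hornerM (at1 P K) ?size_poly// (at1 Q L) ?size_poly//.
  by congr (_ * _); apply: eq_bigr => i _.
- rewrite -sb1 (sbT (filt1 F)) (fE _ _ 1%N); last first.
    by case=> // k _; exact: filt0_0.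
  by rewrite big_ord1/= (gc1 gc).
exists psi => k x Fx; rewrite psiE (sbT Fx) (fE _ _ k.+1); last first.
  by move=> n kn; rewrite gtn_eqF//; exact: filt0_0.
rewrite big_ord_recr/= eqxx big1 ?add0r// => i _.
by rewrite ltn_eqF ?gc0.
Qed.

End CharactersOfGradedCharacters.

(** * The Positivstellensatz *)

Section Positivstellensatz.
Variable C : set A.
Hypothesis C_module : cone_module S C.

Lemma moduleD x y : C x -> C y -> C (x + y).
Proof. by case: C_module => -[_ CD _] _ _; exact: CD. Qed.

Lemma moduleZ (r : R) x : 0 <= r -> C x -> C (r *: x).
Proof. by case: C_module => -[_ _ CZ] _ _; exact: CZ. Qed.

Lemma moduleM t x : S t -> C x -> C (t * x).
Proof. by case: C_module => _ _; apply. Qed.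

(** The preimage of C under clearing denominators; the power s^l makes it
    saturated. *)
Definition homogenization (k : nat) : set A :=
  [set x | F k x /\ exists l, C (s ^+ l * x)].

Lemma homogenization_graded : graded_module homogenization.
Proof.
have raise l n x : C (s ^+ l * x) -> C (s ^+ (n + l) * x).
  move=> Cx; rewrite exprD -mulrA; apply: moduleM => //.
  exact: compatible_semiringX.
split.
- by move=> k x [].
- move=> k x y [Fx [l Cx]] [Fy [l' Cy]]; split; first exact: filtD.
  exists (l + l')%N; rewrite mulrDr; apply: moduleD; last exact: raise.
  by rewrite addnC; exact: raise.
- move=> l k t x St Ft [Fx [n Cx]]; split; first exact: filtM.
  by exists n; rewrite mulrCA; exact: moduleM.
- split; first exact: filt1.
  by exists 0%N; rewrite expr0 mulr1; case: C_module.
- move=> k x Fx [_ [l Cx]]; split=> //; exists l.+1.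
  by rewrite exprSr -mulrA.
Qed.

Lemma homogenization_mem k c : C c -> F k c -> homogenization k c.
Proof. by move=> Cc Fc; split=> //; exists 0%N; rewrite expr0 mul1r. Qed.

(** From t a >= s^(i + k) one reads off a > 0 formally, and t cannot be divided
    out.  Instead, start from a + r s^k in C with r large, and improve: if
    t <= N s^i, then multiplying a + r >= 0 by N - t >= 0 and adding t a >= 1 and
    r t >= 0 gives N a + N r - 1 >= 0, up to powers of s.  So r can be replaced
    by r - 1 / N, and after finitely many such steps r is negative. *)
Lemma strict_certificate k a i t : F k a -> S t -> F i t ->
  C (t * a - s ^+ (i + k)) ->
  exists (eps : R) (l : nat), 0 < eps /\ C (s ^+ l * a - eps *: s ^+ (k + l)).
Proof.
move=> Fa St Ft Cta; have [N N0 [SN _]] := compatible_order_unit Ft.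
have [r0 r00 [Sr0 _]] := compatible_order_unit (filtN Fa).
(* The error term - r t s^(p + k) is compensated by an element of S only
   if r >= 0; the descent stops at the first negative r. *)
have step p r : 0 <= r -> C (s ^+ p * a + r *: s ^+ (p + k)) ->
    C (s ^+ (i + p) * a + (r - N^-1) *: s ^+ (i + p + k)).
  move=> r_ge0 Cr.
  have e : N *: (s ^+ (i + p) * a + (r - N^-1) *: s ^+ (i + p + k)) =
      (N *: s ^+ i - t) * (s ^+ p * a + r *: s ^+ (p + k)) +
      (s ^+ p * (t * a - s ^+ (i + k)) + r *: (t * s ^+ (p + k))).
    by rewrite scalerDr scalerA mulrBr mulfV ?gt_eqF// scalerBl scale1r; alg_ring.
  have NV : N^-1 * N = 1 by rewrite mulVf ?gt_eqF.
  rewrite -[X in C X]scale1r -NV -scalerA e.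
  apply: moduleZ; first by rewrite invr_ge0 ltW.
  apply: moduleD; first exact: moduleM.
  apply: moduleD; first by apply: moduleM => //; exact: compatible_semiringX.
  apply: moduleZ => //; apply: moduleM => //.
  apply: (semiring_sub_module C_module); exact: compatible_semiringX.
have iter_step n : exists p r, (r < 0 \/ r <= r0 - n%:R / N) /\
    C (s ^+ p * a + r *: s ^+ (p + k)).
  elim: n => [|n [p [r [r_le Cr]]]].
    exists 0%N, r0; split; first by right; rewrite mul0r subr0.
    apply: (semiring_sub_module C_module).
    by rewrite expr0 mul1r add0n addrC -[a]opprK.
  have [r_lt0|r_ge0] := ltP r 0; first by exists p, r; split; [left|].
  exists (i + p)%N, (r - N^-1); split; last exact: step.
  right; case: r_le => [|r_le]; first by rewrite ltNge r_ge0.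
  by rewrite -natr1 mulrDl mul1r opprD addrA lerD2r.
have rN0 : 0 <= r0 * N by rewrite mulr_ge0// ltW.
have [p [r [r_le Cr]]] := iter_step (Num.bound (r0 * N)).
exists (- r), p; split; last by rewrite scaleNr opprK addnC.
rewrite oppr_gt0; case: r_le => // /le_lt_trans; apply.
by rewrite subr_lt0 ltr_pdivlMr// archi_boundP.
Qed.

End Positivstellensatz.

End GradedModules.

Theorem theorem9p9 (R : realType) (A : comAlgType R) (F : filtration A)
    (S C : set A) (s : A)
    (S_semiring : cone_semiring S) (S_generating : generating S)
    (C_module : cone_module S C) (s_compatible : compatible F S s)
    (k : nat) (a : A) (Fka : F k a) :
  ((forall phi : {lrmorphism A -> R | *%R}, char C phi -> 0 < phi a) /\
   (forall psi : {lrmorphism symbols F -> R | *%R},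
      char (cone_sb C) psi -> psi (sb F 1 s) = 1 -> 0 < psi (sb F k a)))
  <->
  (exists (eps : R) (l : nat),
     0 < eps /\ [set eps *: s ^+ (k + l) + c | c in C] (s ^+ l * a)).
Proof.
have FsX := compatible_filtX s_compatible.
have Fs := compatible_filt s_compatible.
split=> [[pos_char pos_sb]|[eps [l [eps0 [c Cc ec]]]]]; last first.
  split=> [phi phiC|psi psiC psi_s].
    have phis : 0 < phi s.
      case: s_compatible => -[t St <-] _ _; rewrite rmorphD rmorph1.
      have := phiC t (semiring_sub_module C_module St); lra.
    rewrite -(pmulr_rgt0 _ (exprn_gt0 l phis)) -rmorphXn -rmorphM -ec rmorphD/=.
    rewrite linearZ/= rmorphXn; apply: ltr_wpDr; first exact: phiC.
    by rewrite mulr_gt0 ?exprn_gt0.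
  have psi_sX n : psi (sb F n (s ^+ n)) = 1.
    elim: n => [|n IH]; first by rewrite expr0 sb1 rmorph1.
    by rewrite exprS -[n.+1]add1n -sbM// rmorphM/= psi_s IH mulr1.
  have Fsa : F (l + k)%N (s ^+ l * a) by exact: filtM.
  have Fes : F (l + k)%N (eps *: s ^+ (k + l)).
    by rewrite addnC; exact: filtZ.
  have Fc : F (l + k)%N c.
    have -> : c = s ^+ l * a - eps *: s ^+ (k + l) by rewrite -ec; ring.
    by apply: filtD => //; exact: filtN.
  have -> : psi (sb F k a) = eps + psi (sb F (l + k) c).
    rewrite -[LHS]mul1r -(psi_sX l) -rmorphM sbM// -ec sbD// rmorphD sbZ/=.
      by rewrite linearZ/= addnC psi_sX mulr1.
    by rewrite addnC.
  apply: ltr_wpDr => //; apply: psiC.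
  exists (l + k)%N, (fun n => if n == (l + k)%N then c else 0); split.
    move=> n _; case: eqP => [->//|_]; split; last exact: filt_0.
    by apply: (semiring_sub_module C_module); exact: semiring0.
  rewrite big_nat_recr//= eqxx big_nat big1 ?add0r// => n /andP[_ nlk].
  by rewrite ltn_eqF//; apply/(sb_eq0 (filt_0 F n)); exact: filt0_0.
(* The characters of M are those of C at which a is nonpositive. *)
pose M0 := homogenization F s C.
have gM0 : graded_module F S s M0 by exact: homogenization_graded.
pose M := gm_adjoin F S s M0 k (- a).
have gM : graded_module F S s M by apply: gm_adjoin_graded => //; exact: filtN.
have M0M n : M0 n `<=` M n by exact: gm_sub_adjoin.
have Mc n c : C c -> F n c -> M n c.
  by move=> Cc Fc; apply: M0M; exact: homogenization_mem.
have Mna : M k (- a) by apply: gm_adjoin_mem => //; exact: filtN.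
have [[_ [l [i [m [t [e [Fm [j Cm]] St Ft em]]]]]]|pM] := pselect (M 0%N (- 1)).
  rewrite addn0 in e Fm.
  have [|||eps [p [eps0 Cp]]] := @strict_certificate _ _ _ _ _ S_semiring
    s_compatible _ C_module k a (j + i)%N (s ^+ j * t) Fka.
  - by apply: semiringM => //; exact: (compatible_semiringX S_semiring s_compatible).
  - exact: filtM.
  - have -> : s ^+ j * t * a - s ^+ (j + i + k) = s ^+ j * m; last by [].
    have -> : m = s ^+ l * - 1 + t * a by rewrite em; ring.
    by rewrite e; alg_ring.
  by exists eps, p; split => //; exists (s ^+ p * a - eps *: s ^+ (k + p)) => //; ring.
have [alpha [gc alphaM]] := exists_graded_character S_semiring s_compatible gM pM.
have F1 : F 1%N 1 by apply: (filtS (filt1 F)).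
have Na : alpha k a <= 0.
  have := alphaM _ _ Mna; rewrite -scaleN1r (gcZ gc)// mulN1r.
  by rewrite oppr_ge0.
have u_ge0 : 0 <= alpha 1%N 1.
  apply: alphaM; apply: Mc => //; by case: C_module.
have [u0|u_neq0] := eqVneq (alpha 1%N 1) 0.
  have [psi psiE] := exists_character_symbols gc u0.
  suff : 0 < psi (sb F k a) by rewrite psiE// ltNge Na.
  apply: pos_sb; last by rewrite psiE// (gc_s gc).
  move=> _ [K [c [Cc ->]]]; rewrite rmorph_sum/= big_nat.
  apply: sumr_ge0 => n /andP[_]; rewrite ltnS => /Cc[Ccn Fcn].
  by rewrite psiE//; apply: alphaM; exact: Mc.
have [phi phiE] := exists_character_algebra gc u_neq0.
have u_gt0 n : 0 < alpha 1%N 1 ^+ n by rewrite exprn_gt0// lt_def u_neq0.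
suff : 0 < phi a.
  by rewrite -(pmulr_rgt0 _ (u_gt0 k)) -phiE// ltNge Na.
apply: pos_char => c Cc.
have [n _ Fc] : (\bigcup_n F n) c by rewrite (filt_cover F).
by rewrite -(pmulr_rge0 _ (u_gt0 n)) -phiE//; apply: alphaM; exact: Mc.
Qed.
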